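(* Let $k\in\{\mathbb{R},\mathbb{C}\}$ be fixed. The category $\mathsf{BOR}$ of bornological (Hausdorff and non-Hausdorff) locally convex spaces over $k$, furnished with linear and continuous maps as morphisms, is integral but neither left quasi-abelian nor right quasi-abelian.
   Context: A locally convex space (not assumed Hausdorff) is bornological if every absolutely convex subset that absorbs all bounded sets is a neighbourhood of $0$. An additive category is pre-abelian if every morphism has a kernel and a cokernel. A morphism is called ''a kernel'' (resp. ''a cokernel'') if it is the kernel (resp. cokernel) of some morphism. A class $\mathcal{X}$ of morphisms is stable under pullback if in any pullback square with $a\colon A\to B$, $b\colon A\to C$, $c\colon B\to D$, $d\colon C\to D$ and $c\circ a=d\circ b$, one has $a\in\mathcal{X}$ whenever $d\in\mathcal{X}$; stability under pushout is defined dually. A pre-abelian category is left quasi-abelian if cokernels are stable under pullback, and right quasi-abelian if kernels are stable under pushout. A pre-abelian category is left integral if epimorphisms are stable under pullback, right integral if monomorphisms are stable under pushout, and integral if it is both. *)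

(* Defs.v *)
From HB Require Import structures.
From mathcomp Require Import all_boot all_order all_algebra.
From mathcomp.real_closed Require Import complex.
From mathcomp Require Import all_classical all_reals all_analysis.

Set Implicit Arguments.
Unset Strict Implicit.
Unset Printing Implicit Defensive.

Import Order.TTheory GRing.Theory Num.Theory.
Import numFieldNormedType.Exports.

Local Open Scope classical_set_scope.
Local Open Scope ring_scope.

(* The additive structure of an additive category is carried as data: hom-sets
   are abelian groups and composition is bilinear. [comp g f] is g after f. *)
Record preadditive := Preadditive {
  obj :> Type;
  hom : obj -> obj -> zmodType;
  idm : forall A, hom A A;
  comp : forall A B C, hom B C -> hom A B -> hom A C;
  comp1m : forall A B (f : hom A B), comp (idm B) f = f;
  compm1 : forall A B (f : hom A B), comp f (idm A) = f;
  compA : forall A B C D (h : hom C D) (g : hom B C) (f : hom A B),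
    comp h (comp g f) = comp (comp h g) f;
  compDl : forall A B C (g g' : hom B C) (f : hom A B),
    comp (g + g') f = comp g f + comp g' f;
  compDr : forall A B C (g : hom B C) (f f' : hom A B),
    comp g (f + f') = comp g f + comp g f'
}.

Arguments hom {_}.
Arguments idm {_}.
Arguments comp {_ _ _ _}.

Section Categories.
Variable C : preadditive.
Implicit Types A B D K Q S Z : C.

Definition is_zero_object Z : Prop :=
  forall A, (exists! f : hom A Z, True) /\ (exists! f : hom Z A, True).

Definition is_biproduct A B S (i1 : hom A S) (i2 : hom B S)
    (p1 : hom S A) (p2 : hom S B) : Prop :=
  [/\ comp p1 i1 = idm A, comp p2 i2 = idm B, comp p2 i1 = 0,
      comp p1 i2 = 0 & comp i1 p1 + comp i2 p2 = idm S].

Definition additive_category : Prop :=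
  (exists Z, is_zero_object Z) /\
  (forall A B, exists S (i1 : hom A S) (i2 : hom B S)
     (p1 : hom S A) (p2 : hom S B), is_biproduct i1 i2 p1 p2).

Definition monomorphism A B (f : hom A B) : Prop :=
  forall Z (g h : hom Z A), comp f g = comp f h -> g = h.

Definition epimorphism A B (f : hom A B) : Prop :=
  forall Z (g h : hom B Z), comp g f = comp h f -> g = h.

Definition kernel_of A B (f : hom A B) K (k : hom K A) : Prop :=
  comp f k = 0 /\
  forall Z (g : hom Z A), comp f g = 0 -> exists! u : hom Z K, comp k u = g.

Definition cokernel_of A B (f : hom A B) Q (q : hom B Q) : Prop :=
  comp q f = 0 /\
  forall Z (g : hom B Z), comp g f = 0 -> exists! u : hom Q Z, comp u q = g.

Definition is_a_kernel K A (k : hom K A) : Prop :=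
  exists B (f : hom A B), kernel_of f k.

Definition is_a_cokernel B Q (q : hom B Q) : Prop :=
  exists A (f : hom A B), cokernel_of f q.

Definition pre_abelian : Prop :=
  [/\ additive_category,
      forall A B (f : hom A B), exists K (k : hom K A), kernel_of f k &
      forall A B (f : hom A B), exists Q (q : hom B Q), cokernel_of f q].

(* The squares below are laid out as
<<
        a
     A ---> B
   b |      | c
     v      v
     E ---> D
        d
>> *)
Definition is_pullback A B E D
    (a : hom A B) (b : hom A E) (c : hom B D) (d : hom E D) : Prop :=
  comp c a = comp d b /\
  forall Z (x : hom Z B) (y : hom Z E), comp c x = comp d y ->
    exists! u : hom Z A, comp a u = x /\ comp b u = y.

Definition is_pushout A B E D
    (a : hom A B) (b : hom A E) (c : hom B D) (d : hom E D) : Prop :=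
  comp c a = comp d b /\
  forall Z (x : hom B Z) (y : hom E Z), comp x a = comp y b ->
    exists! u : hom D Z, comp u c = x /\ comp u d = y.

Definition morphism_class := forall A B, hom A B -> Prop.

Definition stable_under_pullback (X : morphism_class) : Prop :=
  forall A B E D (a : hom A B) (b : hom A E) (c : hom B D) (d : hom E D),
    is_pullback a b c d -> X E D d -> X A B a.

Definition stable_under_pushout (X : morphism_class) : Prop :=
  forall A B E D (a : hom A B) (b : hom A E) (c : hom B D) (d : hom E D),
    is_pushout a b c d -> X A B a -> X E D d.

Definition left_quasi_abelian : Prop :=
  pre_abelian /\ stable_under_pullback is_a_cokernel.

Definition right_quasi_abelian : Prop :=
  pre_abelian /\ stable_under_pushout is_a_kernel.

Definition left_integral : Prop :=
  pre_abelian /\ stable_under_pullback epimorphism.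

Definition right_integral : Prop :=
  pre_abelian /\ stable_under_pushout monomorphism.

Definition integral_category : Prop := left_integral /\ right_integral.

End Categories.

Section Bornological.
Variables (k : numFieldType) (E : tvsType k).
Implicit Types A B U : set E.

(* If k is a complex field, [0 < r] forces r to be real. *)
Definition absorbs A B : Prop :=
  exists2 r : k, 0 < r & forall t : k, r <= `|t| -> B `<=` *:%R t @` A.

Definition tvs_bounded B : Prop := forall U, nbhs 0 U -> absorbs U B.

Definition balanced A : Prop :=
  forall (t : k) (x : E), `|t| <= 1 -> A x -> A (t *: x).

Definition absolutely_convex A : Prop := convex_set A /\ balanced A.

Definition bornological : Prop :=
  forall A, absolutely_convex A -> (forall B, tvs_bounded B -> absorbs A B) ->
    nbhs 0 A.

End Bornological.

(* [tvsType k] is locally convex and not assumed Hausdorff. It also carries a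
   uniform structure inducing the topology; bornologicality and the morphisms
   below depend only on the topology. *)
Record bor_space (k : numFieldType) := BorSpace {
  bor_tvs :> tvsType k;
  bor_tvsP : bornological bor_tvs
}.

Record bor_map (k : numFieldType) (E F : bor_space k) := BorMap {
  bor_fun :> {linear E -> F};
  bor_fun_continuous : continuous bor_fun
}.

Section BorMaps.
Variable k : numFieldType.

Lemma bor_map_ext (E F : bor_space k) (f g : bor_map E F) : f =1 g -> f = g.
Proof.
case: f g => [f cf] [g cg] /= fg.
have {}fg : f = g.
  case: f g {cf cg} fg => [f [[fA] [fB]]] [g [[gA] [gB]]] /= /funext fg.
  by subst g; congr (GRing.Linear.Pack (GRing.Linear.Class _ _));
     congr (_ _); apply: Prop_irrelevance.
by subst g; congr BorMap; exact: Prop_irrelevance.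
Qed.

Definition bor_id (E : bor_space k) : bor_map E E :=
  @BorMap k E E idfun (fun x => cvg_id).

Lemma bor_comp_continuous (E F G : bor_space k)
  (g : bor_map F G) (f : bor_map E F) : continuous (g \o f).
Proof.
by move=> x; apply: continuous_comp; exact: bor_fun_continuous.
Qed.

Definition bor_comp (E F G : bor_space k)
    (g : bor_map F G) (f : bor_map E F) : bor_map E G :=
  @BorMap k E G (bor_fun g \o bor_fun f) (@bor_comp_continuous E F G g f).

Section HomGroup.
Variables E F : bor_space k.
Implicit Types f g h : bor_map E F.

Lemma bor_zero_continuous : continuous (\0 : E -> F).
Proof. by move=> x; exact: cvg_cst. Qed.

Definition bor_zero : bor_map E F :=
  @BorMap k E F (\0 : E -> F) bor_zero_continuous.

Lemma bor_opp_continuous f : continuous (\- f).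
Proof.
move=> x; apply: (@continuous_comp _ _ _ f -%R).
  exact: bor_fun_continuous.
exact: opp_continuous.
Qed.

Definition bor_opp f : bor_map E F :=
  @BorMap k E F (\- bor_fun f) (@bor_opp_continuous f).

Lemma bor_add_continuous f g : continuous (f \+ g).
Proof.
move=> x.
apply: (@continuous_comp _ _ _ (fun x => (f x, g x)) (fun y => y.1 + y.2)).
  by apply: cvg_pair; exact: bor_fun_continuous.
exact: add_continuous.
Qed.

Definition bor_add f g : bor_map E F :=
  @BorMap k E F (bor_fun f \+ bor_fun g) (@bor_add_continuous f g).

Lemma bor_addA : associative bor_add.
Proof. by move=> f g h; apply: bor_map_ext => x /=; exact: addrA. Qed.

Lemma bor_addC : commutative bor_add.
Proof. by move=> f g; apply: bor_map_ext => x /=; exact: addrC. Qed.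

Lemma bor_add0 : left_id bor_zero bor_add.
Proof. by move=> f; apply: bor_map_ext => x /=; exact: add0r. Qed.

Lemma bor_addN : left_inverse bor_zero bor_opp bor_add.
Proof. by move=> f; apply: bor_map_ext => x /=; exact: addNr. Qed.

HB.instance Definition _ := gen_eqMixin (bor_map E F).
HB.instance Definition _ := gen_choiceMixin (bor_map E F).
HB.instance Definition _ := GRing.isZmodule.Build (bor_map E F)
  bor_addA bor_addC bor_add0 bor_addN.

End HomGroup.

Lemma bor_comp1m (E F : bor_space k) (f : bor_map E F) :
  bor_comp (bor_id F) f = f.
Proof. exact: bor_map_ext. Qed.

Lemma bor_compm1 (E F : bor_space k) (f : bor_map E F) :
  bor_comp f (bor_id E) = f.
Proof. exact: bor_map_ext. Qed.

Lemma bor_compA (E F G H : bor_space k)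
    (h : bor_map G H) (g : bor_map F G) (f : bor_map E F) :
  bor_comp h (bor_comp g f) = bor_comp (bor_comp h g) f.
Proof. exact: bor_map_ext. Qed.

Lemma bor_compDl (E F G : bor_space k) (g g' : bor_map F G) (f : bor_map E F) :
  bor_comp (g + g') f = bor_comp g f + bor_comp g' f.
Proof. exact: bor_map_ext. Qed.

Lemma bor_compDr (E F G : bor_space k) (g : bor_map F G) (f f' : bor_map E F) :
  bor_comp g (f + f') = bor_comp g f + bor_comp g f'.
Proof. by apply: bor_map_ext => x /=; exact: linearD. Qed.

End BorMaps.

Definition BOR (k : numFieldType) : preadditive :=
  @Preadditive (bor_space k) (fun E F => bor_map E F : zmodType)
    (@bor_id k) (@bor_comp k) (@bor_comp1m k) (@bor_compm1 k)
    (@bor_compA k) (@bor_compDl k) (@bor_compDr k).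

(* Main.v *)
Require Import Defs.
From HB Require Import structures.
From mathcomp Require Import all_boot all_order all_algebra.
From mathcomp.real_closed Require Import complex.
From mathcomp Require Import all_classical all_reals all_analysis.

Set Implicit Arguments.
Unset Strict Implicit.
Unset Printing Implicit Defensive.

Import Order.TTheory GRing.Theory Num.Theory.
Import numFieldNormedType.Exports.

Local Open Scope classical_set_scope.
Local Open Scope ring_scope.

(** A linear map out of a bornological space is continuous as soon as it maps
    bounded sets to bounded sets, so a bornological space can be specified by
    declaring some sets to be bounded. Kernels, cokernels and direct sums arise
    in this way on the algebraic kernel, cokernel and direct sum. As cokernels
    need not be Hausdorff, epimorphisms are the surjections and monomorphisms
    the injections, and integrality reduces to linear algebra.

    For the negative part take [E] with basis [b_n], [c_i], where the [c_i] fall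
    into infinitely many infinite blocks, the sequence [n b_n] is bounded, and so
    is [i c_i] for [i] in any fixed block. Let [lam] be the sum of the
    [b]-coordinates and let [psi] subtract from the [n]-th [b]-coordinate the sum
    of the [c]-coordinates of block [n]. Every neighbourhood of [0] contains some
    [b_n + c_i] with [i] in block [n], where [lam = 1] and [psi = 0]. But bounded
    sets meet finitely many blocks, so [lam] is bounded on the bounded subsets of
    [ker psi]: the functional [lam] is continuous on the kernel of [psi] in the
    category, and not for the topology induced by [E]. Pulling back the cokernel
    of [ker psi /\ ker lam -> E] along an indiscrete line, or pushing out the
    kernel [ker psi -> E] along [lam], separates the two topologies. *)

(** * Disks and bounded sets *)

Section Disks.
Variables (k : numFieldType) (V : lmodType k).
Implicit Types (U W B : set V).

(** Convexity and balancedness in one inequality; unlike [convex_set], it involves no bundled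
    interval coefficients and passes directly to linear preimages. *)
Definition disk U : Prop := forall (a b : k) (x y : V),
  `|a| + `|b| <= 1 -> U x -> U y -> U (a *: x + b *: y).

(* For disks a single scalar suffices, see [absorbsP]. *)
Definition eats U B : Prop :=
  exists2 r : k, 0 < r & forall v, B v -> U (r^-1 *: v).

Lemma disk_balanced U a x : disk U -> `|a| <= 1 -> U x -> U (a *: x).
Proof.
move=> dU a1 Ux; rewrite -[a *: x]addr0 -(scale0r x).
by apply: dU; rewrite ?normr0 ?addr0.
Qed.

Lemma disk_half U x y : disk U -> U (2 *: x) -> U (2 *: y) -> U (x + y).
Proof.
move=> dU Ux Uy.
have -> : x + y = 2^-1 *: (2 *: x) + 2^-1 *: (2 *: y).
  by rewrite !scalerA mulVf ?pnatr_eq0// !scale1r.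
apply: dU => //; rewrite ger0_norm ?invr_ge0 ?ler0n//.
by have := splitr (1 : k); rewrite !mul1r => <-.
Qed.

Lemma diskI U W : disk U -> disk W -> disk (U `&` W).
Proof.
by move=> dU dW a b x y ab [Ux Wx] [Uy Wy]; split; [exact: dU|exact: dW].
Qed.

Lemma eats_le U B (r : k) : disk U -> 0 < r ->
  (forall v, B v -> U (r^-1 *: v)) ->
  forall t v, r <= `|t| -> B v -> U (t^-1 *: v).
Proof.
move=> dU r0 UB t v rt Bv.
have t0 : t != 0 by rewrite -normr_gt0 (lt_le_trans r0).
have -> : t^-1 *: v = (t^-1 * r) *: (r^-1 *: v).
  by rewrite scalerA mulfK ?gt_eqF.
apply: disk_balanced => //; last exact: UB.
by rewrite normrM normfV (gtr0_norm r0) mulrC ler_pdivrMr ?normr_gt0// mul1r.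
Qed.

Lemma eatsI U W B : disk U -> disk W ->
  eats U B -> eats W B -> eats (U `&` W) B.
Proof.
move=> dU dW [r r0 UB] [s s0 WB]; exists (r + s); first exact: addr_gt0.
move=> v Bv; have rs : `|r + s| = r + s by rewrite gtr0_norm// addr_gt0.
split.
  by apply: (eats_le dU r0 UB) => //; rewrite rs lerDl ltW.
by apply: (eats_le dW s0 WB) => //; rewrite rs lerDr ltW.
Qed.

Lemma disk_preimZ U (c : k) : disk U -> disk [set v | U (c *: v)].
Proof.
move=> dU a b x y ab /= Ux Uy.
by rewrite scalerDr !scalerA ![c * _]mulrC -!scalerA; apply: dU.
Qed.

Lemma eats_preimZ U B (c : k) : 0 < c ->
  eats U B -> eats [set v | U (c *: v)] B.
Proof.
move=> c0 [r r0 UB]; exists (c * r); first exact: mulr_gt0.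
move=> v Bv /=; rewrite scalerA invfM mulrA divff ?gt_eqF// mul1r.
exact: UB.
Qed.

End Disks.

Section LinearPreimages.
Variables (k : numFieldType) (V W : lmodType k) (f : {linear V -> W}).

Lemma disk_preim U : disk U -> disk (f @^-1` U).
Proof.
by move=> dU a b x y ab /= Ux Uy; rewrite linearP linearZ; apply: dU.
Qed.

Lemma eats_preim U B : eats U (f @` B) -> eats (f @^-1` U) B.
Proof.
move=> [r r0 UB]; exists r => // v Bv /=; rewrite linearZ.
by apply: UB; exists v.
Qed.

End LinearPreimages.

Arguments disk_preim {k V W} f {U}.
Arguments eats_preim {k V W} f {U B}.

Section TvsDisks.
Variables (k : numFieldType) (E : tvsType k).
Implicit Types U A B : set E.

Lemma convE (x y : convex_lmodType E) (l : {i01 k}) :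
  conv l x y = l%:num *: (x : E) + (1 - l%:num) *: (y : E).
Proof. by []. Qed.

(** For nonzero [a] and [b] put [c = |a| + |b|]. Then [a x + b y] is the convex combination, with
    weights [|a|/c] and [|b|/c], of multiples of [x] and [y] by scalars of modulus [c <= 1]. *)
Lemma absolutely_convexP U : absolutely_convex U <-> disk U.
Proof.
split=> [[cU bU]|dU].
  move=> a b x y ab Ux Uy.
  have [->|a0] := eqVneq a 0.
    rewrite scale0r add0r; apply: bU => //.
    by apply: le_trans ab; rewrite lerDr.
  have [->|b0] := eqVneq b 0.
    rewrite scale0r addr0; apply: bU => //.
    by apply: le_trans ab; rewrite lerDl.
  set c := `|a| + `|b|.
  have c0 : 0 < c by rewrite addr_gt0// normr_gt0.
  have cn0 : c != 0 by rewrite gt_eqF.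
  have l01 : Itv.spec (@Itv.num_sem k) (Itv.Real `[0%Z, 1%Z]) (`|a| / c).
    rewrite /Itv.spec/= /Itv.num_sem ger0_real/= ?in_itv/=; last first.
      by rewrite divr_ge0// ltW.
    by rewrite divr_ge0 ?(ltW c0)//= ler_pdivrMr ?mul1r ?lerDl.
  pose l : {i01 k} := Itv.mk l01.
  have aux (d : k) z : d != 0 -> `|d| <= c -> U z -> U ((c / `|d| * d) *: z).
    move=> d0 dc Uz; apply: bU => //.
    rewrite normrM normrM normfV normr_id -mulrA mulVf ?normr_eq0//.
    by rewrite mulr1 gtr0_norm.
  have := cU ((c / `|a| * a) *: x) ((c / `|b| * b) *: y) l.
  rewrite !inE => /(_ (aux _ _ a0 _ Ux) (aux _ _ b0 _ Uy)).
  rewrite lerDl lerDr => /(_ (normr_ge0 _) (normr_ge0 _)).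
  rewrite convE/= !scalerA.
  have -> : `|a| / c * (c / `|a| * a) = a.
    by rewrite !mulrA mulfVK// divff ?mul1r// normr_eq0.
  have -> : 1 - `|a| / c = `|b| / c.
    by rewrite -(divff cn0) -mulrBl /c addrC addKr.
  have -> // : `|b| / c * (c / `|b| * b) = b.
  by rewrite !mulrA mulfVK// divff ?mul1r// normr_eq0.
split=> [x y l|t x t1 Ux]; last exact: disk_balanced.
rewrite !inE convE => Ux Uy; apply: dU => //.
by rewrite !ger0_norm ?subr_ge0// addrC subrK.
Qed.

Lemma absorbsP U B : disk U -> absorbs U B <-> eats U B.
Proof.
move=> dU; split=> -[r r0 UB]; exists r => //.
  move=> v /(UB r); rewrite gtr0_norm// => /(_ (lexx _)) [u Uu <-].
  by rewrite scalerA mulVf ?gt_eqF// scale1r.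
move=> t rt v Bv; exists (t^-1 *: v).
  exact: (eats_le dU r0 UB).
by rewrite scalerA divff ?scale1r// -normr_gt0 (lt_le_trans r0).
Qed.

Lemma nbhs0_disk U : nbhs 0 U -> exists2 W, disk W & nbhs 0 W /\ W `<=` U.
Proof.
move=> U0; have [C Ccvx [Copen /(_ 0)/= Cb]] := @locally_convex k E.
have [G [CG G0] GU] := Cb _ U0.
have nG : nbhs 0 G by apply: open_nbhs_nbhs; split => //; exact: Copen.
(* the balanced core of a convex neighbourhood *)
exists [set x | forall t : k, `|t| <= 1 -> G (t *: x)].
  apply/absolutely_convexP; split.
    move=> x y l; rewrite !inE => Gx Gy t t1.
    rewrite convE/= scalerDr !scalerA ![t * _]mulrC -!scalerA.
    have := Ccvx G; rewrite inE => /(_ CG (t *: x) (t *: y) l).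
    by rewrite !inE; apply; [exact: Gx|exact: Gy].
  move=> t x t1 Gx s s1; rewrite scalerA; apply: Gx.
  by rewrite normrM mulr_ile1.
split; last by move=> x /(_ 1); rewrite normr1 scale1r => /(_ (lexx _)) /GU.
(* Continuity of scaling at [(0, 0)] gives [e] and [B] with [s z] in [G] for [|s| < e] and [z] in
   [B]; hence the core contains [(e / 2) B]. *)
have /= := @scale_continuous k E (0, 0) G; rewrite scale0r => /(_ nG)[[A B]/=].
move=> [/nbhs_ballP[e /= e0 eA] nB] ABG.
have d0 : 0 < e / 2 by rewrite divr_gt0.
have := nbhs0Z (lt0r_neq0 d0) nB.
apply: filterS => _ [z Bz <-] t t1; rewrite scalerA.
apply: (ABG (t * (e / 2), z)); split => //=; apply: eA.
rewrite -ball_normE/= sub0r normrN normrM (gtr0_norm d0).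
apply: (@le_lt_trans _ _ (e / 2)); first by rewrite ler_piMl// ltW.
by rewrite ltr_pdivrMr// ltr_pMr// ltr1n.
Qed.

Lemma tvs_boundedP B : tvs_bounded B <->
  forall U, disk U -> nbhs 0 U -> eats U B.
Proof.
split=> [bB U dU U0|H U /nbhs0_disk[W dW [W0 WU]]].
  by apply/absorbsP => //; apply: bB.
have /(absorbsP _ dW)[r r0 WB] := H _ dW W0.
exists r => // t rt v /(WB t rt)[u Wu <-]; exists u => //; exact: WU.
Qed.

Lemma tvs_bounded1 (x : E) : tvs_bounded [set x].
Proof.
apply/tvs_boundedP => U dU U0.
have /= := @scale_continuous k E (0, x) U; rewrite scale0r => /(_ U0)[[A B]/=].
move=> [/nbhs_ballP[e /= e0 eA] nB] ABU.
exists (2 / e) => [|v ->]; first by rewrite divr_gt0.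
apply: (ABU ((2 / e)^-1, x)); split => /=; last exact: nbhs_singleton.
apply: eA; rewrite -ball_normE/= sub0r normrN gtr0_norm ?invr_gt0 ?divr_gt0//.
by rewrite invfM invrK mulrC ltr_pdivrMr// ltr_pMr// ltr1n.
Qed.

End TvsDisks.

(** * Topologies generated by bounded sets *)

Section BornologicalTopology.
Variables (k : numFieldType) (V : lmodType k).

(** The last clause makes the disk absorbing, which scalar multiplication needs in order to be
    continuous at nonzero vectors. *)
Definition eating_disk (S : set (set V)) (U : set V) : Prop :=
  [/\ disk U, forall B, S B -> eats U B & forall x, eats U [set x]].

(* [V] with the finest locally convex topology for which the members of [S] are
   bounded; it is always bornological ([gen_bornP]). *)
Definition gen_born (S : set (set V)) : Type := V.

Variable S : set (set V).
Local Notation G := (gen_born S).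

HB.instance Definition _ := GRing.Lmodule.on G.

Definition gen_nbhs (x : G) : set_system G :=
  [set A | exists2 U, eating_disk S U & forall u, U u -> A (x + u)].

HB.instance Definition _ := hasNbhs.Build G gen_nbhs.

Lemma eating_diskI U W :
  eating_disk S U -> eating_disk S W -> eating_disk S (U `&` W).
Proof.
move=> [dU SU pU] [dW SW pW]; split; first exact: diskI.
  by move=> B SB; apply: eatsI => //; [exact: SU|exact: SW].
by move=> x; apply: eatsI.
Qed.

Lemma eating_diskZ U (c : k) : 0 < c ->
  eating_disk S U -> eating_disk S [set v | U (c *: v)].
Proof.
move=> c0 [dU SU pU]; split; first exact: disk_preimZ.
  by move=> B /SU; apply: eats_preimZ.
by move=> x; apply: eats_preimZ.
Qed.

Lemma eating_disk0 U : eating_disk S U -> U 0.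
Proof. by move=> [_ _ /(_ 0)[r r0 /(_ 0 erefl)]]; rewrite scaler0. Qed.

Let gen_filter (x : G) : ProperFilter (nbhs x).
Proof.
split; last first.
  split.
  - exists setT => //; split => // [B _|y]; exists 1 => //; exact: ltr01.
  - move=> A B [U eU UA] [W eW WB]; exists (U `&` W); first exact: eating_diskI.
    by move=> u [/UA ? /WB].
  - by move=> A B AB [U eU UA]; exists U => // u /UA /AB.
by move=> [U eU /(_ 0)]; apply; apply: eating_disk0.
Qed.

Let gen_singleton (x : G) (A : set G) : nbhs x A -> A x.
Proof.
by move=> [U eU /(_ 0)]; rewrite addr0; apply; apply: eating_disk0.
Qed.

Let gen_nbhs_nbhs (x : G) (A : set G) : nbhs x A -> nbhs x (nbhs^~ A).
Proof.
move=> [U eU UA]; exists [set v | U (2 *: v)]; first exact: eating_diskZ.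
move=> u /= Uu; exists [set v | U (2 *: v)]; first exact: eating_diskZ.
move=> v /= Uv; rewrite -addrA; apply: UA; apply: disk_half => //.
by case: eU.
Qed.

HB.instance Definition _ :=
  Nbhs_isNbhsTopological.Build G gen_filter gen_singleton gen_nbhs_nbhs.

Let gen_add_continuous : continuous (fun x : G * G => x.1 + x.2).
Proof.
move=> [x y] A /= [U eU UA].
exists ([set x + v | v in [set v | U (2 *: v)]],
        [set y + v | v in [set v | U (2 *: v)]]).
  by split => /=; exists [set v | U (2 *: v)];
    (do [exact: eating_diskZ]) || (move=> u Uu; exists u).
move=> [_ _] /= [[u Uu <-] [v Uv <-]]; rewrite addrACA; apply: UA.
by apply: disk_half => //; case: eU.
Qed.

Let gen_scale_continuous : continuous (fun z : k^o * G => z.1 *: z.2).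
Proof.
move=> [s x] A /= [U eU UA].
have [dU _ /(_ x)[r r0 /(_ x erefl) Ux]] := eU.
(* Write [t (x + v) = s x + ((t - s) x + t v)]. The choice of [e] puts [2 (t - s) x] in [U], and
   that of [c], which bounds [|2 t|], puts [2 t v] there. *)
pose e : k := (2 * r)^-1.
have e0 : 0 < e by rewrite invr_gt0 mulr_gt0.
pose c : k := 2 * (`|s| + e).
have c0 : 0 < c by rewrite mulr_gt0// ltr_wpDl.
exists (ball s e, [set x + v | v in [set v | U (c *: v)]]).
  split => /=; first exact: nbhsx_ballx.
  by exists [set v | U (c *: v)]; [exact: eating_diskZ|move=> u Uu; exists u].
move=> [t _] /= [+ [v Uv <-]]; rewrite -ball_normE/= => ste.
have -> : t *: ((x : V) + v) = s *: (x : V) + ((t - s) *: (x : V) + t *: v).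
  by rewrite addrA -scalerDl [s + _]addrC subrK scalerDr.
apply: UA; apply: disk_half => //; rewrite scalerA.
  have -> : 2 * (t - s) = (2 * (t - s) * r) * r^-1 by rewrite mulfK ?gt_eqF.
  rewrite -scalerA; apply: disk_balanced => //.
  rewrite mulrAC normrM (gtr0_norm (mulr_gt0 _ r0))// distrC.
  rewrite -[leRHS](@divff _ (2 * r)) ?gt_eqF ?mulr_gt0// ler_pM2l ?mulr_gt0//.
  exact: ltW.
have -> : 2 * t = (2 * t / c) * c by rewrite mulfVK ?gt_eqF.
rewrite -scalerA; apply: disk_balanced => //.
rewrite normrM normfV (gtr0_norm c0) ler_pdivrMr// mul1r normrM gtr0_norm//.
rewrite ler_pM2l// -[t](subrK s) addrC (le_trans (ler_normD _ _))// lerD2l.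
by rewrite distrC ltW.
Qed.

Let gen_locally_convex : exists2 B : set_system G,
  (forall b, b \in B -> convex_set b) & basis B.
Proof.
exists [set A | open A /\ convex_set A]; first by move=> b; rewrite inE => -[].
split; first by move=> b [].
move=> x A [U eU UA]; pose W := [set x + u | u in U].
(* The basic open set is the interior of [x + U], which inherits convexity from [U]. *)
exists [set y : G | nbhs y W]; last first.
  by move=> y /= /gen_singleton[u Uu <-]; apply: UA.
split; last by exists U => // u Uu; exists u.
split; first by rewrite openE => y /= /gen_nbhs_nbhs.
move=> y z l; rewrite !inE => -[Uy eUy yW] [Uz eUz zW].
exists (Uy `&` Uz); first exact: eating_diskI.
move=> v [/yW[u1 Uu1 yv] /zW[u2 Uu2 zv]].
exists (l%:num *: u1 + (1 - l%:num) *: u2).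
  case: eU => dU _ _; apply: dU => //.
  by rewrite !ger0_norm ?subr_ge0// addrC subrK.
have -> : conv l y z = l%:num *: (y : V) + (1 - l%:num) *: (z : V) by [].
have -> : v = l%:num *: v + (1 - l%:num) *: v.
  by rewrite -scalerDl [_ + (1 - _)]addrC subrK scale1r.
rewrite addrACA -!scalerDr -yv -zv !scalerDr addrACA -scalerDl.
by rewrite [_ + (1 - _)]addrC subrK scale1r.
Qed.

HB.instance Definition _ := PreTopologicalLmod_isTvs.Build k G
  gen_add_continuous gen_scale_continuous gen_locally_convex.
HB.instance Definition _ :=
  PreTopologicalNmodule_isTopologicalNmodule.Build G gen_add_continuous.
HB.instance Definition _ :=
  TopologicalNmodule_isTopologicalLmodule.Build k G gen_scale_continuous.
HB.instance Definition _ := Uniform_isTvs.Build k G gen_locally_convex.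

Lemma nbhs0_gen_born (U : set G) :
  nbhs (0 : G) U <-> exists2 W, eating_disk S W & W `<=` U.
Proof.
by split=> -[W eW WU]; exists W => // u /WU; rewrite add0r.
Qed.

Lemma gen_born_bounded B : S B -> tvs_bounded (B : set G).
Proof.
move=> SB; apply/tvs_boundedP => U dU /nbhs0_gen_born[W [_ eW _] WU].
by have [r r0 WB] := eW _ SB; exists r => // v /WB /WU.
Qed.

(** A disk that absorbs all bounded sets absorbs the members of [S] and the points, so it is itself
    a basic neighbourhood. *)
Lemma gen_bornP : bornological G.
Proof.
move=> A /absolutely_convexP dA bA; apply/nbhs0_gen_born; exists A => //.
split=> // [B /gen_born_bounded /bA|x].
  by move=> /(@absorbsP k G A B dA).
by apply/(@absorbsP k G A _ dA)/bA/tvs_bounded1.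
Qed.

Definition gen_bor : bor_space k := BorSpace gen_bornP.

End BornologicalTopology.

(** * Continuity and boundedness of linear maps *)

Section ContinuousMaps.
Variable k : numFieldType.

Lemma linear_continuous0 (E F : tvsType k) (f : {linear E -> F}) :
  (forall U : set F, disk U -> nbhs 0 U -> nbhs (0 : E) (f @^-1` U)) ->
  continuous f.
Proof.
move=> f0 x A /= nA.
have [U dU [U0 UA]] :
    exists2 U : set F, disk U & nbhs 0 U /\ U `<=` [set u | A (f x + u)].
  apply: nbhs0_disk.
  have := nbhsB (- f x) nA; rewrite addNr; apply: filterS => _ [u Au <-] /=.
  by rewrite addrA subrr add0r.
have := nbhsT x (f0 _ dU U0).
by apply: filterS => _ [u /= /UA/= Au <-]; rewrite linearD.
Qed.

Lemma linear_continuous_bounded (E F : tvsType k) (f : {linear E -> F}) B :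
  continuous f -> tvs_bounded B -> tvs_bounded (f @` B).
Proof.
move=> cf /tvs_boundedP bB; apply/tvs_boundedP => U dU U0.
have fU : nbhs (0 : E) (f @^-1` U) by apply: cf; rewrite linear0.
have [r r0 rB] := bB _ (disk_preim f dU) fU.
by exists r => // _ [v Bv <-]; rewrite -linearZ; apply: rB.
Qed.

Lemma bornological_continuous (E F : tvsType k) (f : {linear E -> F}) :
  bornological E -> (forall B, tvs_bounded B -> tvs_bounded (f @` B)) ->
  continuous f.
Proof.
move=> bE fB; apply: linear_continuous0 => U dU U0.
have dfU := disk_preim f dU.
apply: bE; first exact/absolutely_convexP.
move=> B /fB/tvs_boundedP/(_ U dU U0) eU.
by apply/(@absorbsP k E _ B dfU)/(eats_preim f).
Qed.

(** The preimage of a disk neighbourhood is an eating disk as soon as the declared sets are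
    absorbed; the other bounded sets need not be tested. *)
Lemma gen_born_continuous (V : lmodType k) (S : set (set V)) (F : tvsType k)
    (f : {linear gen_born S -> F}) :
  (forall B, S B -> tvs_bounded (f @` B)) -> continuous f.
Proof.
move=> fB; apply: linear_continuous0 => U dU U0.
apply/nbhs0_gen_born; exists (f @^-1` U) => //.
split; first exact: (disk_preim f dU).
  by move=> B /fB/tvs_boundedP/(_ U dU U0) eU; apply: (eats_preim f).
move=> x; apply: (eats_preim f); rewrite image_set1.
by move/tvs_boundedP : (tvs_bounded1 (f x)); apply.
Qed.

Lemma bor_map_exists (E F : bor_space k) (f : E -> F) : linear f ->
  (forall B : set E, tvs_bounded B -> tvs_bounded (f @` B)) ->
  exists g : bor_map E F, g =1 f.
Proof.
move=> lf fB.
pose g : {linear E -> F} := HB.pack f (GRing.isLinear.Build k E F _ f lf).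
by exists (@BorMap k E F g
  (@bornological_continuous E F g (@bor_tvsP k E) fB)).
Qed.

Lemma bor_map_into_gen (V : lmodType k) (S : set (set V)) (E : bor_space k)
    (f : E -> V) : linear f ->
  (forall B : set E, tvs_bounded B -> S (f @` B)) ->
  exists g : bor_map E (gen_bor S), forall x, g x = f x.
Proof.
move=> lf fB; apply: (@bor_map_exists E (gen_bor S) f lf).
by move=> B /fB; apply: gen_born_bounded.
Qed.

Lemma bor_map_from_gen (V : lmodType k) (S : set (set V)) (F : bor_space k)
    (f : V -> F) : linear f ->
  (forall B, S B -> tvs_bounded (f @` B)) ->
  exists g : bor_map (gen_bor S) F, forall x, g x = f x.
Proof.
move=> lf fB.
pose g : {linear gen_born S -> F} :=
  HB.pack (f : gen_born S -> F) (GRing.isLinear.Build k (gen_born S) F _ f lf).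
by exists (@BorMap k (gen_bor S) F g (@gen_born_continuous V S F g fB)).
Qed.

Lemma bor_map_bounded (E F : bor_space k) (f : bor_map E F) B :
  tvs_bounded B -> tvs_bounded (f @` B).
Proof. by apply: linear_continuous_bounded; apply: bor_fun_continuous. Qed.

End ContinuousMaps.

(** * Test spaces *)

Section TestObjects.
Variable k : numFieldType.

(* The finest locally convex topology on [k], which is the usual one. Points of
   [E] are the same as morphisms [line -> E]. *)
Definition line : bor_space k := gen_bor (set0 : set (set k^o)).

(** An eating disk must absorb all of [V], hence equals [V]. *)
Definition indiscrete (V : lmodType k) : bor_space k :=
  gen_bor (setT : set (set V)).

Lemma line_map (E : bor_space k) (x : E) :
  exists f : bor_map line E, forall t : k^o, f t = t *: x.
Proof.
apply: (@bor_map_from_gen k k^o set0 E (fun t => t *: x)) => //.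
by move=> a u v /=; rewrite scalerDl scalerA.
Qed.

Lemma indiscrete_map (E : bor_space k) (V : lmodType k) (f : E -> V) :
  linear f -> exists g : bor_map E (indiscrete V), forall x, g x = f x.
Proof. by move=> lf; apply: bor_map_into_gen. Qed.

Lemma line_bounded (B : set k^o) (c : k) :
  (forall t, B t -> `|t| <= c) -> tvs_bounded (B : set line).
Proof.
move=> Bc; apply/tvs_boundedP => U dU /nbhs0_gen_born[W [dW _ W1] WU].
have [r r0 /(_ 1 erefl) Wr] := W1 1.
(* If [B] is empty, [c] may be negative or not real; [|c| + 1] is positive in every case. *)
exists (r * (`|c| + 1)) => [|t Bt]; first by rewrite mulr_gt0// ltr_wpDl.
apply: WU.
have c0 : 0 < `|c| + 1 by rewrite ltr_wpDl.
have -> : (r * (`|c| + 1))^-1 *: (t : k^o) =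
    ((`|c| + 1)^-1 * t) *: (r^-1 *: (1 : k^o)).
  by rewrite /GRing.scale/= mulr1 invfM -mulrA mulrC.
apply: disk_balanced => //.
rewrite normrM normfV (gtr0_norm c0) mulrC ler_pdivrMr// mul1r.
have t0 := normr_ge0 t.
rewrite (le_trans (Bc _ Bt))// (le_trans (real_ler_norm _)) ?lerDl//.
by rewrite ger0_real// (le_trans t0 (Bc _ Bt)).
Qed.

End TestObjects.

(** * Kernels, cokernels and direct sums *)

Section SubmoduleQuotient.
Variables (k : numFieldType) (V W : lmodType k) (f : {linear V -> W}).

Definition ker_pred : {pred V} := fun x => f x == 0.

Let ker_pred_closed : submod_closed ker_pred.
Proof.
split; first by rewrite unfold_in linear0.
move=> a x y; rewrite !unfold_in => /eqP fx /eqP fy.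
by rewrite linearP fx fy scaler0 addr0.
Qed.

HB.instance Definition _ :=
  GRing.isSubmodClosed.Build k V ker_pred ker_pred_closed.

Definition ker_type : Type := {x : V | ker_pred x}.

HB.instance Definition _ := SubChoice.on ker_type.
HB.instance Definition _ := [SubChoice_isSubLmodule of ker_type by <:].

Definition im_pred : {pred W} := fun y => `[< exists x, f x = y >].

Let im_pred_closed : zmod_closed im_pred.
Proof.
split; first by apply/asboolP; exists 0; rewrite linear0.
move=> x y /asboolP[u <-] /asboolP[v <-]; apply/asboolP.
by exists (u - v); rewrite linearB.
Qed.

HB.instance Definition _ := GRing.isZmodClosed.Build W im_pred im_pred_closed.

Definition coker_type : Type := Quotient.quot im_pred.
HB.instance Definition _ := GRing.Zmodule.on coker_type.

Definition coker_pi (y : W) : coker_type := (\pi_(Quotient.quot im_pred) y)%qT.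

Lemma coker_pi_surj (q : coker_type) : exists y, coker_pi y = q.
Proof. by exists (repr (q : Quotient.quot im_pred)); exact: reprK. Qed.

Lemma coker_piP x y : coker_pi x = coker_pi y <-> exists u, f u = x - y.
Proof.
have -> : (coker_pi x = coker_pi y) <-> (x - y \in im_pred).
  by rewrite Quotient.idealrBE; split=> [/eqP|/eqP].
by split=> /asboolP.
Qed.

Lemma coker_piD x y : coker_pi (x + y) = coker_pi x + coker_pi y.
Proof. exact: (raddfD (\pi_(Quotient.quot im_pred))%qT). Qed.

(** The quotient is taken of additive groups, and scalars act through representatives; [coker_piZ]
    gives independence of the choice. *)
Definition coker_scale (a : k) (q : coker_type) : coker_type :=
  coker_pi (a *: repr (q : Quotient.quot im_pred)).

Lemma coker_piZ a x : coker_pi (a *: x) = coker_scale a (coker_pi x).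
Proof.
apply/coker_piP.
have [u fu] : exists u, f u = x - repr (coker_pi x : Quotient.quot im_pred).
  by apply/coker_piP; rewrite /coker_pi reprK.
by exists (a *: u); rewrite linearZ/= fu scalerBr.
Qed.

Let coker_scaleA a b q :
  coker_scale a (coker_scale b q) = coker_scale (a * b) q.
Proof. by have [x <-] := coker_pi_surj q; rewrite -!coker_piZ scalerA. Qed.

Let coker_scale1 : left_id 1 coker_scale.
Proof.
by move=> q; have [x <-] := coker_pi_surj q; rewrite -coker_piZ scale1r.
Qed.

Let coker_scaleDr : right_distributive coker_scale +%R.
Proof.
move=> a q r; have [x <-] := coker_pi_surj q; have [y <-] := coker_pi_surj r.
by rewrite -coker_piD -!coker_piZ scalerDr coker_piD.
Qed.

Let coker_scaleDl q : {morph coker_scale^~ q : a b / a + b}.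
Proof.
move=> a b /=; have [x <-] := coker_pi_surj q.
by rewrite -!coker_piZ scalerDl coker_piD.
Qed.

HB.instance Definition _ := GRing.Zmodule_isLmodule.Build k coker_type
  coker_scaleA coker_scale1 coker_scaleDr coker_scaleDl.

Lemma coker_pi_linear : linear coker_pi.
Proof. by move=> a x y; rewrite coker_piD coker_piZ. Qed.

End SubmoduleQuotient.

Section PreAbelian.
Variable k : numFieldType.
Implicit Types E F : bor_space k.

Lemma bor_zero_object : exists Z, @is_zero_object (BOR k) Z.
Proof.
exists (indiscrete 'rV[k]_0) => E; split; exists 0; split=> // g _.
  by apply: bor_map_ext => x; apply/rowP => -[].
apply: bor_map_ext => x.
have -> : x = 0 by apply/rowP => -[].
by rewrite !linear0.
Qed.

(** Declaring subsets of products of bounded sets to be bounded makes injections and projections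
    continuous. The identities are kept pointwise for computing in pullbacks and pushouts. *)
Lemma bor_direct_sum E F :
  exists S (i1 : bor_map E S) (i2 : bor_map F S)
    (p1 : bor_map S E) (p2 : bor_map S F),
    [/\ forall x, p1 (i1 x) = x, forall y, p2 (i2 y) = y,
        forall x, p2 (i1 x) = 0, forall y, p1 (i2 y) = 0 &
        forall s, i1 (p1 s) + i2 (p2 s) = s].
Proof.
pose S : set (set (E * F)%type) := [set B | exists (B1 : set E) (B2 : set F),
  [/\ tvs_bounded B1, tvs_bounded B2 & B `<=` B1 `*` B2]].
have [i1 i1E] : exists g : bor_map E (gen_bor S), forall x, g x = (x, 0).
  apply: bor_map_into_gen.
    move=> a x y; apply: injective_projections => //=.
    by rewrite scaler0 addr0.
  move=> B bB; exists B, [set 0]; split=> //; first exact: tvs_bounded1.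
  by move=> _ [x Bx <-].
have [i2 i2E] : exists g : bor_map F (gen_bor S), forall x, g x = (0, x).
  apply: bor_map_into_gen.
    move=> a x y; apply: injective_projections => //=.
    by rewrite scaler0 addr0.
  move=> B bB; exists [set 0], B; split=> //; first exact: tvs_bounded1.
  by move=> _ [x Bx <-].
have sub_bounded (G : bor_space k) (A B : set G) :
  A `<=` B -> tvs_bounded B -> tvs_bounded A.
  move=> AB bB U /bB[r r0 rB]; exists r => // t rt.
  exact: subset_trans AB (rB t rt).
have [p1 p1E] : exists g : bor_map (gen_bor S) E, forall x : E * F, g x = x.1.
  apply: bor_map_from_gen => // B [B1 [B2 [b1 _ BB]]].
  by apply: sub_bounded b1 => _ [x /BB[] ? _ <-].
have [p2 p2E] : exists g : bor_map (gen_bor S) F, forall x : E * F, g x = x.2.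
  apply: bor_map_from_gen => // B [B1 [B2 [_ b2 BB]]].
  by apply: sub_bounded b2 => _ [x /BB[] _ ? <-].
exists (gen_bor S), i1, i2, p1, p2; split=> x.
- by rewrite i1E p1E.
- by rewrite i2E p2E.
- by rewrite i1E p2E.
- by rewrite i2E p1E.
rewrite i1E i2E p1E p2E.
by apply: injective_projections; rewrite /= ?addr0 ?add0r.
Qed.

Lemma bor_biproduct E F :
  exists S (i1 : bor_map E S) (i2 : bor_map F S)
    (p1 : bor_map S E) (p2 : bor_map S F),
    @is_biproduct (BOR k) E F S i1 i2 p1 p2.
Proof.
have [S [i1 [i2 [p1 [p2 [h1 h2 h3 h4 h5]]]]]] := bor_direct_sum E F.
by exists S, i1, i2, p1, p2; split; apply: bor_map_ext => x /=.
Qed.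

(** A set is declared bounded when it is bounded in [E]. The resulting topology is finer than the
    induced one, possibly strictly. *)
Lemma bor_kernel E F (f : bor_map E F) :
  exists K (j : bor_map K E), @kernel_of (BOR k) E F f K j.
Proof.
pose S : set (set (ker_type f)) := [set B | tvs_bounded (val @` B : set E)].
have [j jE] : exists j : bor_map (gen_bor S) E, forall x, j x = val x.
  by apply: bor_map_from_gen => // a x y; rewrite linearP.
exists (gen_bor S), j; split.
  by apply: bor_map_ext => x /=; rewrite jE; apply/eqP; exact: (valP x).
move=> Z g fg0.
have fg z : f (g z) = 0 by exact: (congr1 (fun h : bor_map Z F => h z) fg0).
have fg' z : ker_pred f (g z) by apply/eqP.
have [u uE] : exists u : bor_map Z (gen_bor S), forall z,
      u z = exist (fun x => ker_pred f x) (g z) (fg' z).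
  apply: bor_map_into_gen => [a x y|B bB].
    by apply: val_inj; rewrite /= linearP.
  rewrite /S/= image_comp; exact: (bor_map_bounded g bB).
exists u; split=> [|v jv]; first by apply: bor_map_ext => z /=; rewrite jE uE.
apply: bor_map_ext => z; apply: val_inj; rewrite uE/= -jE.
by rewrite -jv.
Qed.

(** The second conclusion records that the quotient is by the image itself and not by its
    closure. *)
Lemma bor_cokernel E F (f : bor_map E F) :
  exists Q (q : bor_map F Q), @cokernel_of (BOR k) E F f Q q /\
    forall y, q y = 0 -> exists x, f x = y.
Proof.
pose S : set (set (coker_type f)) :=
  [set A | exists2 B : set F, tvs_bounded B & A = coker_pi f @` B].
have [q qE] : exists q : bor_map F (gen_bor S), forall x, q x = coker_pi f x.
  apply: bor_map_into_gen => [|B bB]; first exact: coker_pi_linear.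
  by exists B.
exists (gen_bor S), q; split; last first.
  move=> y; rewrite qE -[0](_ : coker_pi f 0 = _); last first.
    by rewrite -qE linear0.
  by move/coker_piP; rewrite subr0.
split.
  apply: bor_map_ext => x /=; rewrite qE; transitivity (coker_pi f 0).
    by apply/coker_piP; exists x; rewrite subr0.
  by rewrite -qE linear0.
move=> Z g gf0.
have gf z : g (f z) = 0 by exact: (congr1 (fun h : bor_map E Z => h z) gf0).
pose u0 (c : coker_type f) : Z := g (repr (c : Quotient.quot (im_pred f))).
have u0E y : u0 (coker_pi f y) = g y.
  have [x fx] : exists x,
      f x = y - repr (coker_pi f y : Quotient.quot (im_pred f)).
    by apply/coker_piP; rewrite /coker_pi reprK.
  by apply/esym/eqP; rewrite -subr_eq0 -linearB -fx gf.
have [u uE] : exists u : bor_map (gen_bor S) Z, forall c, u c = u0 c.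
  apply: bor_map_from_gen => [a c d|_ [B bB ->]].
    have [x <-] := coker_pi_surj c; have [y <-] := coker_pi_surj d.
    by rewrite -coker_pi_linear !u0E linearP.
  rewrite image_comp (_ : _ @` B = g @` B); first exact: bor_map_bounded.
  by apply: eq_imagel => y _ /=; rewrite u0E.
exists u; split=> [|v vq].
  by apply: bor_map_ext => y /=; rewrite qE uE u0E.
apply: bor_map_ext => c; have [y <-] := coker_pi_surj c.
by rewrite uE u0E -vq /= qE.
Qed.

Lemma bor_pre_abelian : pre_abelian (BOR k).
Proof.
split; first by split; [exact: bor_zero_object|exact: bor_biproduct].
  exact: bor_kernel.
by move=> E F f; have [Q [q [qf _]]] := bor_cokernel f; exists Q, q.
Qed.

End PreAbelian.

(** * Integrality *)

Section Integral.
Variable k : numFieldType.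
Implicit Types E F : bor_space k.

Lemma bor_comp_eq E F F' Z (c : bor_map F Z) (a : bor_map E F)
    (d : bor_map F' Z) (b : bor_map E F') :
  bor_comp c a = bor_comp d b -> forall x, c (a x) = d (b x).
Proof. by move=> cadb x; exact: (congr1 (fun h : bor_map E Z => h x) cadb). Qed.

(** A vector killed by [f] is a morphism out of [line] killed by [f]. *)
Lemma bor_monoP E F (f : bor_map E F) :
  @monomorphism (BOR k) E F f <-> forall x, f x = 0 -> x = 0.
Proof.
split=> [mf x fx|fi Z g h fgh].
  have [g gE] := line_map x.
  have : g = 0 :> bor_map (line k) E.
    apply: mf; apply: bor_map_ext => t /=.
    by rewrite gE linearZ/= fx scaler0 linear0.
  move/(congr1 (fun h : bor_map (line k) E => h (1 : k^o))).
  by rewrite gE scale1r.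
apply: bor_map_ext => z; apply/eqP; rewrite -subr_eq0; apply/eqP/fi.
by rewrite linearB (bor_comp_eq fgh) subrr.
Qed.

(** An epimorphism has zero cokernel map, and the null space of that map is exactly the image. *)
Lemma bor_epiP E F (f : bor_map E F) :
  @epimorphism (BOR k) E F f <-> forall y, exists x, f x = y.
Proof.
split=> [ef y|fs Z g h gfh].
  have [Q [q [[qf _] qker]]] := bor_cokernel f.
  have q0 : q = 0 by apply: ef; rewrite qf; apply: bor_map_ext.
  by apply: qker; rewrite q0.
apply: bor_map_ext => y; have [x <-] := fs y.
exact: (bor_comp_eq gfh).
Qed.

Lemma bor_pullback_lift (A B E D : bor_space k) (a : bor_map A B)
    (b : bor_map A E) (c : bor_map B D) (d : bor_map E D) x y :
  @is_pullback (BOR k) A B E D a b c d -> c x = d y ->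
  exists2 p, a p = x & b p = y.
Proof.
move=> [cadb pb] cxdy.
have [gx gxE] := line_map x; have [gy gyE] := line_map y.
have [u [[au bu] _]] : exists! u : bor_map (line k) A,
    bor_comp a u = gx /\ bor_comp b u = gy.
  apply: pb; apply: bor_map_ext => t /=.
  by rewrite gxE gyE !linearZ/= cxdy.
exists (u (1 : k^o)).
  by rewrite -[RHS]scale1r -gxE -au.
by rewrite -[RHS]scale1r -gyE -bu.
Qed.

Lemma bor_left_integral : left_integral (BOR k).
Proof.
split; first exact: bor_pre_abelian.
move=> A B E D a b c d pb /bor_epiP ds; apply/bor_epiP => x.
have [y dy] := ds (c x).
by have [p ap _] := bor_pullback_lift pb (esym dy); exists p.
Qed.

Lemma bor_right_integral : right_integral (BOR k).
Proof.
split; first exact: bor_pre_abelian.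
move=> A B E D a b c d [cadb po] /bor_monoP ai; apply/bor_monoP => y dy.
have [S [i1 [i2 [p1 [p2 [h1 h2 h3 h4 _]]]]]] := bor_direct_sum B E.
(* the cokernel of [(a, -b)] tests the injectivity of [d] *)
pose f : bor_map A S := (bor_comp i1 a : bor_map A S) - bor_comp i2 b.
have fE s : f s = i1 (a s) - i2 (b s) by [].
have [Q [q [[qf _] qker]]] := bor_cokernel f.
have [u [[_ ud] _]] : exists! u : bor_map D Q,
    bor_comp u c = bor_comp q i1 /\ bor_comp u d = bor_comp q i2.
  apply: po; apply: bor_map_ext => s /=; apply/eqP.
  rewrite -subr_eq0 -linearB -fE; apply/eqP.
  exact: (congr1 (fun h : bor_map A Q => h s) qf).
(* Since [q (i2 y) = u (d y) = 0], the pair [(0, y)] is [(a s, - b s)] for some [s]; the first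
   coordinate forces [s = 0]. *)
have [s fs] : exists s, f s = i2 y.
  by apply: qker; rewrite -(bor_comp_eq ud) dy linear0.
have s0 : s = 0.
  apply: ai; rewrite -[LHS]subr0 -(h4 (b s)).
  by rewrite -{1}(h1 (a s)) -linearB -fE fs h4.
by rewrite -(h2 y) -fs s0 !linear0.
Qed.

Lemma bor_integral : integral_category (BOR k).
Proof. by split; [exact: bor_left_integral|exact: bor_right_integral]. Qed.

End Integral.

(** * Failure of quasi-abelianness *)

Lemma kernel_mono (C : preadditive) (A B K : C) (f : Defs.hom A B)
  (j : Defs.hom K A) : kernel_of f j -> monomorphism j.
Proof.
move=> [fj kj] Z g h jgh.
have [|u [_ uniq]] := kj Z (Defs.comp j g).
  (* Composition with zero vanishes by additivity and cancellation. *)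
  rewrite Defs.compA fj; apply: (addrI (Defs.comp (0 : Defs.hom K B) g)).
  by rewrite -compDl !addr0.
by rewrite -(uniq g)// -(uniq h).
Qed.

(** * Pullbacks and pushouts *)

Section Limits.
Variable k : numFieldType.

Lemma bor_kernel_lift (E F K : bor_space k) (f : bor_map E F) (j : bor_map K E)
    x : @kernel_of (BOR k) E F f K j -> f x = 0 -> exists m, j m = x.
Proof.
move=> [fj kj] fx; have [g gE] := line_map x.
have [u [ju _]] : exists! u : bor_map (line k) K, bor_comp j u = g.
  apply: kj; apply: bor_map_ext => t /=.
  by rewrite gE linearZ/= fx scaler0.
by exists (u (1 : k^o)); rewrite -[RHS]scale1r -gE -ju.
Qed.

Lemma bor_pullback (B E D : bor_space k) (c : bor_map B D) (d : bor_map E D) :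
  exists A (a : bor_map A B) (b : bor_map A E),
    @is_pullback (BOR k) A B E D a b c d.
Proof.
have [S [i1 [i2 [p1 [p2 [h1 h2 h3 h4 hS]]]]]] := bor_direct_sum B E.
pose f : bor_map S D := (bor_comp c p1 : bor_map S D) - bor_comp d p2.
have fE s : f s = c (p1 s) - d (p2 s) by [].
have [A [j kj]] := bor_kernel f; have [fj uj] := kj.
exists A, (bor_comp p1 j), (bor_comp p2 j); split.
  apply: bor_map_ext => z /=; apply/eqP; rewrite -subr_eq0 -fE; apply/eqP.
  exact: (congr1 (fun h : bor_map A D => h z) fj).
move=> Z x y cxdy.
pose g : bor_map Z S := (bor_comp i1 x : bor_map Z S) + bor_comp i2 y.
have gE z : g z = i1 (x z) + i2 (y z) by [].
have [u [ju uu]] : exists! u : bor_map Z A, bor_comp j u = g.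
  apply: uj; apply: bor_map_ext => z /=.
  change (f (g z) = 0); rewrite fE gE !linearD h1 h2 h3 h4 !linear0 addr0 add0r.
  by apply/eqP; rewrite subr_eq0; apply/eqP; exact: (bor_comp_eq cxdy).
have juE z : j (u z) = i1 (x z) + i2 (y z).
  exact: (congr1 (fun h : bor_map Z S => h z) ju).
exists u; split.
  split; apply: bor_map_ext => z /=; rewrite juE !linearD.
    by rewrite h1 h4 addr0.
  by rewrite h2 h3 add0r.
move=> v [vx vy]; apply: uu; apply: bor_map_ext => z /=.
by change (j (v z) = g z); rewrite gE -[LHS]hS -vx -vy.
Qed.

Lemma bor_pushout (A B E : bor_space k) (a : bor_map A B) (b : bor_map A E) :
  exists D (c : bor_map B D) (d : bor_map E D),
    @is_pushout (BOR k) A B E D a b c d.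
Proof.
have [S [i1 [i2 [p1 [p2 [h1 h2 h3 h4 hS]]]]]] := bor_direct_sum B E.
pose f : bor_map A S := (bor_comp i1 a : bor_map A S) - bor_comp i2 b.
have fE s : f s = i1 (a s) - i2 (b s) by [].
have [D [q [[qf uq] _]]] := bor_cokernel f.
exists D, (bor_comp q i1), (bor_comp q i2); split.
  apply: bor_map_ext => z /=; apply/eqP.
  rewrite -subr_eq0 -linearB -fE; apply/eqP.
  exact: (congr1 (fun h : bor_map A D => h z) qf).
move=> Z x y xayb.
pose g : bor_map S Z := (bor_comp x p1 : bor_map S Z) + bor_comp y p2.
have gE z : g z = x (p1 z) + y (p2 z) by [].
have [u [qu uu]] : exists! u : bor_map D Z, bor_comp u q = g.
  apply: uq; apply: bor_map_ext => z /=.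
  change (g (f z) = 0).
  rewrite gE fE !linearB h1 h2 h3 h4 !linear0 ?(subr0, addr0) sub0r.
  by apply/eqP; rewrite subr_eq0; apply/eqP; exact: (bor_comp_eq xayb).
have quE z : u (q z) = x (p1 z) + y (p2 z).
  exact: (congr1 (fun h : bor_map S Z => h z) qu).
exists u; split.
  split; apply: bor_map_ext => z /=; rewrite quE.
    by rewrite h1 h3 linear0 addr0.
  by rewrite h2 h4 linear0 add0r.
move=> v [vx vy]; apply: uu; apply: bor_map_ext => z /=.
by change (v (q z) = g z); rewrite gE -[in LHS](hS z) !linearD -vx -vy.
Qed.

End Limits.

(* The kernel of [psi] splits as [ker lam /\ ker psi] plus a line. By
   [lam_dense], the summand [ker lam /\ ker psi] is dense in it for the topology
   of [E]; by [lam_bounded], it is closed for the associated bornological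
   topology. *)
Section NotQuasiAbelian.
Variables (k : numFieldType) (E : bor_space k) (W : lmodType k).
Variables (lam : {linear E -> k^o}) (psi : {linear E -> W}).
Hypothesis lam_dense : forall U : set E, nbhs (0 : E) U ->
  exists v, [/\ U v, lam v = 1 & psi v = 0].
Hypothesis lam_bounded : forall B : set E, tvs_bounded B ->
  (forall v, B v -> psi v = 0) ->
  exists c : k, forall v, B v -> `|lam v : k| <= c.

Lemma lam_dense_scale (U : set E) (t : k) : nbhs (0 : E) U ->
  exists v, [/\ U v, lam v = t & psi v = 0].
Proof.
move=> nU; have [->|t0] := eqVneq t 0.
  by exists 0; rewrite !linear0; split => //; exact: nbhs_singleton.
have [_ [[w Uw <-]]] := lam_dense (nbhs0Z (invr_neq0 t0) nU).
rewrite !linearZ/= => lamw psiw; exists w; split => //.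
  rewrite -[LHS]scale1r -(divff t0) -scalerA lamw.
  by rewrite /GRing.scale/= mulr1.
by rewrite -[LHS]scale1r -(divff t0) -scalerA psiw scaler0.
Qed.

(** By linearity [u] is the identity, so all of [k] would be bounded in [line]; but if [r] times the
    unit ball contained [k], it would contain [2 r]. *)
Lemma line_not_indiscrete (u : bor_map (indiscrete k^o) (line k)) :
  u (1 : k^o) = (1 : k^o) -> False.
Proof.
move=> u1.
have uE (t : k^o) : u t = t.
  have e : t = t *: (1 : k^o) by rewrite /GRing.scale/= mulr1.
  have -> : u t = t *: u (1 : k^o) by rewrite -linearZ -e.
  by rewrite u1 -e.
have : tvs_bounded (u @` setT).
  by apply: bor_map_bounded; apply: gen_born_bounded.
pose U : set (line k) := [set t : k^o | `|t : k| <= 1].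
have dU : disk U.
  move=> a b x y ab Ux Uy; rewrite /U/=.
  rewrite (le_trans (ler_normD _ _))// (le_trans _ ab)// !normrM.
  by rewrite lerD// ler_piMr.
move/tvs_boundedP => /(_ U dU)[].
  apply/nbhs0_gen_born; exists U => //; split => // x.
  have c0 : 0 < `|x : k| + 1 by rewrite ltr_wpDl.
  exists (`|x : k| + 1) => // _ ->.
  by rewrite /U/= normrM normfV (gtr0_norm c0) mulrC ler_pdivrMr// mul1r lerDl.
move=> r r0 /(_ (2 * r : k^o)) H.
have /H : (u @` setT) (2 * r : k^o) by exists (2 * r : k^o) => //; exact: uE.
rewrite /U/= /GRing.scale/= mulrCA mulVf ?gt_eqF// mulr1 ger0_norm ?ler0n//.
by rewrite lern1.
Qed.

Lemma not_left_quasi_abelian : ~ left_quasi_abelian (BOR k).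
Proof.
move=> [_ pbs].
have [x [_ lamx psix]] := lam_dense (filterT : nbhs (0 : E) setT).
(* With an indiscrete target every linear map is a morphism, so [K] is [ker lam /\ ker psi] as a
   vector space. *)
have [Psi PsiE] : exists g : bor_map E (indiscrete (k^o * W)%type),
    forall v, g v = (lam v, psi v).
  by apply: indiscrete_map => a u v; rewrite !linearP.
have [K [j kj]] := bor_kernel Psi.
have [D [q [[qj uq] _]]] := bor_cokernel j.
have qj0 m : q (j m) = 0 by exact: (congr1 (fun h : bor_map K D => h m) qj).
have [h [hq _]] : exists! h : bor_map D (indiscrete (k^o * W)%type),
    bor_comp h q = Psi by apply: uq; case: kj.
have hE v : h (q v) = (lam v, psi v) by rewrite -PsiE -hq.
(* [x] lies in the closure of [ker Psi], so its image is in the closure of [0] *)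
have lift (U : set D) (t : k) : nbhs (0 : D) U -> U (t *: q x).
  move=> nU.
  have nqU : nbhs (0 : E) (q @^-1` U).
    by apply: bor_fun_continuous; rewrite linear0.
  have [v [Uv lamv psiv]] := lam_dense_scale t nqU.
  have [m jm] : exists m, j m = v - t *: x.
    apply: (bor_kernel_lift kj); rewrite PsiE.
    rewrite !linearB !linearZ/= lamv lamx psiv psix oppr0 scaler0 addr0.
    by rewrite /GRing.scale/= mulrN1 subrr.
  by rewrite -linearZ -[t *: x](subKr v) -jm linearB qj0 subr0.
have [c cE] : exists c : bor_map (indiscrete k^o) D,
    forall t : k^o, c t = t *: q x.
  apply: (@bor_map_from_gen k k^o setT D (fun t => t *: q x)).
    by move=> a u v /=; rewrite scalerDl scalerA.
  move=> B _; apply/tvs_boundedP => U dU nU; exists 1 => // _ [t _ <-].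
  by rewrite scalerA; apply: lift.
(* [q] is a cokernel, but the topology of [P] makes [a] continuous into [line] *)
have [P [a [b pab]]] := bor_pullback c q.
have abE p : lam (b p) = a p /\ psi (b p) = 0.
  have : h (c (a p)) = h (q (b p)) by congr (h _); apply: bor_comp_eq pab.1 p.
  rewrite hE cE linearZ/= hE lamx psix => -[<- <-].
  by split; rewrite ?scaler0// /GRing.scale/= mulr1.
(* On [P] the map [a] is [lam] after [b], and [b] sends bounded sets to bounded subsets of
   [ker psi], where [lam] is bounded. *)
have [phi phiE] : exists f : bor_map P (line k), forall p, f p = a p.
  apply: (@bor_map_exists k P (line k) (fun p => a p)).
    by move=> r u v; rewrite linearP.
  move=> B bB.
  have [r lamr] : exists r : k, forall v, (b @` B) v -> `|lam v : k| <= r.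
    apply: lam_bounded; first exact: bor_map_bounded.
    by move=> _ [p _ <-]; case: (abE p).
  apply: (@line_bounded _ _ r) => _ [p Bp <-].
  by have [<- _] := abE p; apply: lamr; exists p.
have [Z [g [ag ua]]] : is_a_cokernel
    (a : Defs.hom (P : BOR k) (indiscrete k^o : BOR k)).
  by apply: pbs pab _; exists K, j.
(* [phi] has the values of [a], so it kills [g] and factors through [a] by a map fixing 1. *)
have [u [ua1 _]] : exists! u : bor_map (indiscrete k^o) (line k),
    bor_comp u a = phi.
  apply: ua; apply: bor_map_ext => z; rewrite /= phiE.
  exact: (congr1 (fun h : bor_map Z (indiscrete k^o) => h z) ag).
have [p ap _] : exists2 p, a p = (1 : k^o) & b p = x.
  by apply: bor_pullback_lift pab _; rewrite cE scale1r.
apply: (@line_not_indiscrete u).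
by rewrite -ap -[RHS]phiE -ua1.
Qed.

Lemma not_right_quasi_abelian : ~ right_quasi_abelian (BOR k).
Proof.
move=> [_ pos].
have [psi' psiE] : exists g : bor_map E (indiscrete W), forall v, g v = psi v.
  by apply: indiscrete_map => a u v; rewrite linearP.
have [M [j kj]] := bor_kernel psi'.
have psij m : psi (j m) = 0.
  rewrite -psiE.
  exact: (congr1 (fun h : bor_map M (indiscrete W) => h m) kj.1).
have [phi phiE] : exists f : bor_map M (line k), forall m, f m = lam (j m).
  apply: (@bor_map_exists k M (line k) (fun m => lam (j m))).
    by move=> r u v; rewrite !linearP.
  move=> B bB.
  have [r lamr] : exists r : k, forall v, (j @` B) v -> `|lam v : k| <= r.
    by apply: lam_bounded; [exact: bor_map_bounded|move=> _ [m _ <-]].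
  by apply: (@line_bounded _ _ r) => _ [m Bm <-]; apply: lamr; exists m.
have [D [c [d cd]]] := bor_pushout j phi.
have [Z [h kd]] : is_a_kernel (d : Defs.hom (line k : BOR k) (D : BOR k)).
  by apply: pos cd _; exists (indiscrete W), psi'.
(* [d] maps [line] into the closure of [0] *)
have lift (U : set D) (t : k^o) : nbhs (0 : D) U -> U (d t).
  move=> nU.
  have ncU : nbhs (0 : E) (c @^-1` U).
    by apply: bor_fun_continuous; rewrite linear0.
  have [v [Uv lamv psiv]] := lam_dense_scale t ncU.
  have [m jm] : exists m, j m = v by apply: (bor_kernel_lift kj); rewrite psiE.
  have <- : phi m = t by rewrite phiE jm.
  by rewrite -(bor_comp_eq cd.1) jm.
have [e eE] : exists e : bor_map (indiscrete k^o) D, forall t : k^o, e t = d t.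
  apply: (@bor_map_from_gen k k^o setT D (fun t => d t)).
    by move=> r u v; rewrite linearP.
  move=> B _; apply/tvs_boundedP => U dU nU; exists 1 => // _ [t _ <-].
  by rewrite -linearZ; apply: lift.
(* [e] has the values of [d], so it factors through the kernel [d]; injectivity of [d] forces the
   factor to fix 1. *)
have [u [du _]] : exists! u : bor_map (indiscrete k^o) (line k),
    bor_comp d u = e.
  apply: kd.2; apply: bor_map_ext => t; rewrite /= eE.
  exact: (congr1 (fun f : bor_map (line k) Z => f t) kd.1).
apply: (@line_not_indiscrete u).
have /bor_monoP di := kernel_mono kd.
apply/eqP; rewrite -subr_eq0; apply/eqP/di.
by rewrite linearB -(eE (1 : k^o)) -du subrr.
Qed.

End NotQuasiAbelian.

(** * Polynomials as finitely supported sequences *)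

Section FinitelySupported.
Variable k : numFieldType.

Section Extension.
Variables (V : lmodType k) (F : nat -> V).

Definition poly_ext (q : {poly k}) : V := \sum_(i < size q) q`_i *: F i.

Lemma poly_extE (N : nat) (q : {poly k}) : (size q <= N)%N ->
  poly_ext q = \sum_(i < N) q`_i *: F i.
Proof.
move=> sN; rewrite /poly_ext (big_ord_widen N (fun i => q`_i *: F i) sN).
rewrite big_mkcond; apply: eq_bigr => i _; case: ltnP => // si.
by rewrite nth_default// scale0r.
Qed.

Lemma poly_ext_linear : linear poly_ext.
Proof.
move=> a p q; pose N := maxn (size p) (size q).
rewrite (@poly_extE N) ?(@poly_extE N p) ?(@poly_extE N q)
  ?leq_maxl ?leq_maxr//.
  rewrite scaler_sumr -big_split; apply: eq_bigr => i _ /=.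
  by rewrite coefD coefZ scalerDl scalerA.
rewrite (leq_trans (size_polyD _ _))// geq_max leq_maxr andbT.
by rewrite (leq_trans (size_scale_leq _ _))// leq_maxl.
Qed.

Lemma poly_extXn n : poly_ext 'X^n = F n.
Proof.
rewrite (@poly_extE n.+1) ?size_polyXn// big_ord_recr/= coefXn eqxx scale1r.
rewrite big1 ?add0r// => i _.
by rewrite coefXn eqn_leq [(n <= _)%N]leqNgt ltn_ord andbF scale0r.
Qed.

End Extension.

Section Weights.
Variable w : nat -> k.
Hypothesis w0 : forall i, 0 <= w i.

(** A weighted l1 seminorm; weights may vanish. *)
Definition wnorm (q : {poly k}) : k := \sum_(i < size q) w i * `|q`_i|.

Lemma wnormE (N : nat) (q : {poly k}) : (size q <= N)%N ->
  wnorm q = \sum_(i < N) w i * `|q`_i|.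
Proof.
move=> sN; rewrite /wnorm (big_ord_widen N (fun i => w i * `|q`_i|) sN).
rewrite big_mkcond; apply: eq_bigr => i _; case: ltnP => // si.
by rewrite nth_default// normr0 mulr0.
Qed.

Lemma wnorm_le a b p q :
  wnorm (a *: p + b *: q) <= `|a| * wnorm p + `|b| * wnorm q.
Proof.
pose N := maxn (size p) (size q).
rewrite (@wnormE N) ?(@wnormE N p) ?(@wnormE N q)
  ?leq_maxl ?leq_maxr//; last first.
  by rewrite (leq_trans (size_polyD _ _))// geq_max
    !(leq_trans (size_scale_leq _ _))
    ?leq_maxl ?leq_maxr.
rewrite !mulr_sumr -big_split; apply: ler_sum => i _ /=.
rewrite coefD !coefZ !(mulrCA `|_|) -mulrDr ler_wpM2l// -!normrM.
exact: ler_normD.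
Qed.

Lemma wnormZ a q : wnorm (a *: q) = `|a| * wnorm q.
Proof.
rewrite (@wnormE (size q)) ?size_scale_leq// /wnorm mulr_sumr.
by apply: eq_bigr => i _; rewrite coefZ normrM mulrCA.
Qed.

Lemma wnorm_ge0 q : 0 <= wnorm q.
Proof. by apply: sumr_ge0 => i _; rewrite mulr_ge0. Qed.

Lemma wnorm_coef (q : {poly k}) i : w i * `|q`_i| <= wnorm q.
Proof.
rewrite (@wnormE (maxn (size q) i.+1)) ?leq_maxl//.
have lti : (i < maxn (size q) i.+1)%N by rewrite leq_maxr.
rewrite (bigD1 (Ordinal lti))//= lerDl.
by apply: sumr_ge0 => j _; rewrite mulr_ge0.
Qed.

Lemma wnormXn n : wnorm 'X^n = w n.
Proof.
rewrite (@wnormE n.+1) ?size_polyXn// big_ord_recr/= coefXn eqxx normr1 mulr1.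
rewrite big1 ?add0r// => i _.
by rewrite coefXn eqn_leq [(n <= _)%N]leqNgt ltn_ord andbF normr0 mulr0.
Qed.

Section Ball.
Variables (V : lmodType k) (f : {linear V -> {poly k}}).

Definition wball : set V := [set v | wnorm (f v) <= 1].

Lemma disk_wball : disk wball.
Proof.
move=> a b x y ab Ux Uy; rewrite /wball/= linearD !linearZ/=.
rewrite (le_trans (wnorm_le _ _ _ _))// (le_trans _ ab)//.
by rewrite lerD// ler_piMr.
Qed.

Lemma eats_wball (B : set V) (c : k) : 0 <= c ->
  (forall v, B v -> wnorm (f v) <= c) -> eats wball B.
Proof.
move=> c0 Bc; exists (c + 1) => [|v Bv]; first by rewrite ltr_wpDl.
have c1 : 0 < c + 1 by rewrite ltr_wpDl.
rewrite /wball/= linearZ wnormZ normfV (gtr0_norm c1) mulrC ler_pdivrMr// mul1r.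
by rewrite (le_trans (Bc _ Bv))// lerDl.
Qed.

Lemma wball_bounded (B : set V) : eats wball B ->
  exists2 r : k, 0 < r & forall v, B v -> wnorm (f v) <= r.
Proof.
move=> [r r0 UB]; exists r => // v /UB; rewrite /wball/= linearZ wnormZ.
by rewrite normfV (gtr0_norm r0) mulrC ler_pdivrMr// mul1r.
Qed.

End Ball.
End Weights.
End FinitelySupported.

(** The only property of the scalars that the counterexample uses, so the real and complex cases are
    treated together. *)
Definition archimedean (k : numFieldType) : Prop :=
  forall x : k, exists n : nat, `|x| <= n%:R.

Lemma real_archimedean (R : realType) : archimedean R.
Proof.
by move=> x; exists (Num.bound `|x|); rewrite ltW// (@archi_boundP R).
Qed.

Lemma complex_archimedean (R : realType) : archimedean R[i].
Proof.
move=> x; have [n xn] := @real_archimedean R (complex.Re `|x|).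
exists n.
have -> : `|x| = (complex.Re `|x|)%:C%C by rewrite RRe_real// normr_real.
rewrite -(rmorph_nat (real_complex R)) lecR (le_trans _ xn)//.
exact: (@ler_norm R).
Qed.

(** * The counterexample space *)

Section Example.
Variable k : numFieldType.
Hypothesis archi_k : archimedean k.

Let V : lmodType k := ({poly k} * {poly k})%type.

(* With [b_n] the monomial [X^n] of the first factor, [c_i] the monomial [X^i] of
   the second one and the [c_i] grouped in infinite blocks according to [n =
   logn 2 i], the sequences [n b_n] and, for each block, [i c_i] are declared to
   be bounded. *)
Definition block_gens : set (set V) :=
  [set B | B = [set (n%:R *: 'X^n, 0) | n in setT] \/
    exists n, B = [set (0, i%:R *: 'X^i) | i in [set i | logn 2 i = n]]].

Let E : bor_space k := gen_bor block_gens.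

Let evalone_linear : linear (fun v : E => v.1.[1] : k^o).
Proof. by move=> a u v; rewrite hornerD hornerZ. Qed.

(** Evaluation at 1 sums the coordinates: this is [lam], while [defect] below is [psi]. *)
Definition evalone : {linear E -> k^o} :=
  HB.pack (fun v : E => v.1.[1] : k^o)
    (GRing.isLinear.Build k E k^o _ _ evalone_linear).

Definition collapse : {poly k} -> {poly k} :=
  poly_ext (fun i => 'X^(logn 2 i) : {poly k}).

Let defect_linear : linear (fun v : E => v.1 - collapse v.2).
Proof.
move=> a u v; rewrite /collapse /= poly_ext_linear opprD addrACA.
by rewrite scalerBr.
Qed.

Definition defect : {linear E -> {poly k}} :=
  HB.pack (fun v : E => v.1 - collapse v.2)
    (GRing.isLinear.Build k E {poly k} _ _ defect_linear).

(** If [n v] lies in [r U], then [n >= 2 r] puts [v] in half of [U], as [disk_half] requires. *)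
Lemma disk_shrink (U : set V) (r : k) (n : nat) v : disk U -> 0 < r ->
  (0 < n)%N -> `|2 * r| <= n%:R -> U (r^-1 *: (n%:R *: v)) -> U (2 *: v).
Proof.
move=> dU r0 n0 rn Uv.
have nn0 : n%:R != 0 :> k by rewrite pnatr_eq0 -lt0n.
have -> : 2 *: v = (2 * r / n%:R) *: (r^-1 *: (n%:R *: v)).
  by rewrite !scalerA [r^-1 * _]mulrC mulrA mulfVK// mulfK ?gt_eqF.
apply: disk_balanced => //.
by rewrite normrM normfV normr_nat ler_pdivrMr ?ltr0n// mul1r.
Qed.

(** First [n] is taken large for the bounded sequence of the [n b_n]; this fixes the block, in which
    [i] is then taken far out. *)
Lemma evalone_dense (U : set E) : nbhs (0 : E) U ->
  exists v, [/\ U v, evalone v = 1 & defect v = 0].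
Proof.
move=> /nbhs0_gen_born[D [dD SD _] DU].
have [r r0 rD] := SD _ (or_introl erefl).
have [n rn] := archi_k (2 * r).
have [s s0 sD] := SD _ (or_intror (ex_intro _ n.+1 erefl)).
have [m sm] := archi_k (2 * s).
(* The odd factor keeps [i] in block [n.+1] and makes it at least [m]. *)
pose i := (2 ^ n.+1 * (m.*2.+1))%N.
have logi : logn 2 i = n.+1.
  rewrite /i lognM ?expn_gt0// pfactorK// lognE/= dvdn2/= odd_double.
  by rewrite addn0.
have i0 : (0 < i)%N by rewrite muln_gt0 expn_gt0.
have mi : (m <= i)%N.
  rewrite /i (leq_trans _ (leq_pmull _ _)) ?expn_gt0//.
  by rewrite (leq_trans _ (leqnSn _))// -addnn leq_addr.
exists ('X^(n.+1), 'X^i); split.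
- apply: DU.
  have -> : ('X^(n.+1), 'X^i) = (('X^(n.+1), 0) : V) + (0, 'X^i).
    by apply: injective_projections; rewrite /= ?addr0 ?add0r.
  apply: disk_half => //.
    apply: (@disk_shrink _ r n.+1) => //.
      by rewrite (le_trans rn)// ler_nat.
    apply: rD; exists n.+1 => //.
    by apply: injective_projections; rewrite /= ?scaler0.
  apply: (@disk_shrink _ s i) => //; first by rewrite (le_trans sm)// ler_nat.
  apply: sD; exists i => //.
  by apply: injective_projections; rewrite /= ?scaler0.
- by rewrite /= hornerXn expr1n.
- by rewrite /= /collapse poly_extXn logi subrr.
Qed.

Let fst_linear : linear (fst : V -> {poly k}). Proof. by []. Qed.
Let snd_linear : linear (snd : V -> {poly k}). Proof. by []. Qed.

Let pfst : {linear V -> {poly k}} :=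
  HB.pack (fst : V -> {poly k})
    (GRing.isLinear.Build k V {poly k} _ _ fst_linear).
Let psnd : {linear V -> {poly k}} :=
  HB.pack (snd : V -> {poly k})
    (GRing.isLinear.Build k V {poly k} _ _ snd_linear).

(** A seminorm bounded on each generating set has a neighbourhood of 0 as unit ball, hence is
    bounded on every bounded set. *)
Lemma bounded_wnorm (w : nat -> k) (w0 : forall i, 0 <= w i)
    (f : {linear V -> {poly k}}) (B : set E) :
  (forall B, block_gens B ->
    exists2 c, 0 <= c & forall v, B v -> wnorm w (f v) <= c) ->
  tvs_bounded B ->
  exists2 r : k, 0 < r & forall v, B v -> wnorm w (f v) <= r.
Proof.
move=> fB /tvs_boundedP bB; apply: wball_bounded; apply: bB.
  exact: disk_wball.
apply/nbhs0_gen_born; exists (wball w f) => //; split.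
- exact: disk_wball.
- by move=> B' /fB[c c0 cB]; apply: (eats_wball c0).
- by move=> x; apply: (eats_wball (wnorm_ge0 w0 (f x))) => _ ->.
Qed.

Lemma bounded_blocks (B : set E) : tvs_bounded B ->
  exists r : nat, forall v i, B v -> (r < logn 2 i)%N -> v.2`_i = 0.
Proof.
move=> bB.
(* weights growing so fast that a bounded set meets finitely many blocks *)
have /choice[b bP] : forall n, exists b : k, 0 <= b /\
    ((exists v i, [/\ B v, logn 2 i = n & v.2`_i != 0]) ->
     exists v i, [/\ B v, logn 2 i = n &
       (0 < n)%N -> n%:R <= b / i%:R * `|v.2`_i|]).
  move=> n; have [[v [i [Bv ni vi]]]|nex] :=
      pselect (exists v i, [/\ B v, logn 2 i = n & v.2`_i != 0]); last first.
    by exists 0; split.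
  (* This value makes the weighted coefficient exactly [n]. Block 0 is exempt because it contains
     [i = 0], where division by [i] degenerates. *)
  exists (n%:R * i%:R / `|v.2`_i|); split; first by rewrite divr_ge0// mulr_ge0.
  move=> _; exists v, i; split => // n0.
  have i0 : i%:R != 0 :> k.
    by rewrite pnatr_eq0; apply: contraTneq n0 => i0; rewrite -ni i0 logn0.
  by rewrite [_ * i%:R / _]mulrAC mulfK// mulfVK// normr_eq0.
(* On the generators [i c_i] of block [n] this seminorm is at most [b n], so it is bounded on [B];
   yet it reaches [n] whenever [B] meets block [n > 0]. *)
pose w i := b (logn 2 i) / i%:R.
have w0 i : 0 <= w i by rewrite divr_ge0//; case: (bP (logn 2 i)).
have [|r r0 rB] := @bounded_wnorm w w0 psnd B _ bB.
  move=> _ [->|[n ->]].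
    by exists 0 => // _ [n _ <-] /=; rewrite /wnorm size_poly0 big_ord0.
  exists (b n); first by case: (bP n).
  move=> _ [i /= <- <-] /=; rewrite wnormZ wnormXn normr_nat /w mulrC.
  have [->|i0] := eqVneq i 0%N; first by rewrite mulr0; case: (bP (logn 2 0)).
  by rewrite mulfVK// pnatr_eq0.
have [m rm] := archi_k r.
exists m => v i Bv mi; apply/eqP; apply: contraTT mi => vi; rewrite -leqNgt.
have [_ []] := bP (logn 2 i); first by exists v, i.
move=> u [j [Bu ji]]; case: (posnP (logn 2 i)) => [->//|ipos] /(_ isT).
rewrite -ji -[b _ / _]/(w j) => le1.
rewrite -(ler_nat k) (le_trans le1)// (le_trans (wnorm_coef w0 _ _))//.
by rewrite (le_trans (rB _ Bu))// (le_trans _ rm)// gtr0_norm.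
Qed.

(** On the kernel of [defect] the [n]-th coordinate of [v.1] is the sum over block [n] of [v.2], so
    it vanishes for [n > m]; finitely many bounded coordinates remain. *)
Lemma evalone_bounded (B : set E) : tvs_bounded B ->
  (forall v, B v -> defect v = 0) ->
  exists c : k, forall v, B v -> `|evalone v : k| <= c.
Proof.
move=> bB dB; have [m mB] := bounded_blocks bB.
(* The generators [n b_n] get seminorm [n / (n + 1) <= 1], and for [n <= m] the weight is at least
   [1 / (m + 1)], whence the bound [(m + 1) r]. *)
pose w (n : nat) : k := n.+1%:R^-1.
have w0 n : 0 <= w n by rewrite invr_ge0.
have [|r r0 rB] := @bounded_wnorm w w0 pfst B _ bB.
  move=> _ [->|[n ->]].
    exists 1 => // _ [n _ <-] /=; rewrite wnormZ wnormXn normr_nat /w.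
    by rewrite ler_pdivrMr ?ltr0n// mul1r ler_nat.
  by exists 0 => // _ [i _ <-] /=; rewrite /wnorm size_poly0 big_ord0.
exists (m.+1%:R * r) => v Bv.
have v0 n : (m < n)%N -> v.1`_n = 0.
  move=> mn; have /eqP := dB _ Bv; rewrite /= subr_eq0 => /eqP ->.
  rewrite /collapse /poly_ext coef_sum big1// => i _.
  rewrite coefZ coefXn; case: eqP => [ni|_]; last by rewrite mulr0.
  by rewrite (mB v i Bv) ?mul0r// -ni.
rewrite /= horner_coef (le_trans (ler_norm_sum _ _ _))//.
apply: le_trans (ler_wpM2l (ler0n _ _) (rB _ Bv)).
rewrite /wnorm mulr_sumr; apply: ler_sum => n _.
rewrite expr1n mulr1 /w mulrA.
have [mn|nm] := ltnP m n; first by rewrite v0// normr0 mulr0.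
by rewrite ler_peMl// ler_pdivlMr ?ltr0n// mul1r ler_nat.
Qed.

Lemma bor_not_left_quasi_abelian : ~ left_quasi_abelian (BOR k).
Proof. exact: not_left_quasi_abelian evalone_dense evalone_bounded. Qed.

Lemma bor_not_right_quasi_abelian : ~ right_quasi_abelian (BOR k).
Proof. exact: not_right_quasi_abelian evalone_dense evalone_bounded. Qed.

End Example.

Theorem theorem3p5 (R : realType) (k : numFieldType)
    (hk : k = R :> numFieldType \/ k = R[i] :> numFieldType) :
  integral_category (BOR k) /\
  ~ left_quasi_abelian (BOR k) /\
  ~ right_quasi_abelian (BOR k).
Proof.
have archi_k : archimedean k.
  by case: hk => ->; [exact: real_archimedean|exact: complex_archimedean].
split; first exact: bor_integral.
split; first exact: bor_not_left_quasi_abelian.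
exact: bor_not_right_quasi_abelian.
Qed.
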